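(* Let $S = \langle n_1, \ldots, n_k\rangle$ be a numerical semigroup with fixed generators $n_1 < \cdots < n_k$, and let $f : \mathbb{Z} \to \mathbb{R}$ be an $S$-invariant. Then for any fixed $p \in \mathbb{Z}_{\ge 1}$, the augmented Hilbert series $\mathcal{H}_f(S;t) = \sum_{n \in S} f(n) t^n$ satisfies $$\mathcal{H}_f(S;t) = \frac{\sum_{n \in S} \big(f(n) - 2f(n-p) + f(n-2p)\big) t^n}{(1-t^p)^2} = \frac{\sum_{n \in S} \chi_f(\Delta_n)\, t^n}{\prod_{i=1}^k (1 - t^{n_i})}.$$
   Context: A numerical semigroup is a subset $S \subseteq \mathbb{Z}_{\ge 0}$ containing $0$, closed under addition, with finite complement; $S = \langle n_1, \ldots, n_k\rangle$ means $S$ is generated by the positive integers $n_1 < \cdots < n_k$ (a fixed generating set). A function $f:\mathbb{Z} \to \mathbb{R}$ is an $S$-invariant if $f(n) = 0$ for all $n \notin S$. For $F \subseteq [k] = \{1,\ldots,k\}$ put $n_F = \sum_{i \in F} n_i$. For $n \in S$, the squarefree divisor complex $\Delta_n$ is the simplicial complex on $[k]$ whose faces are the $F \subseteq [k]$ (including $F = \emptyset$) with $n - n_F \in S$. The weighted Euler characteristic of $\Delta_n$ with respect to $f$ is $$\chi_f(\Delta_n) = \sum_{F \in \Delta_n} (-1)^{|F|} f(n - n_F).$$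
   Formalization: The first equality as printed fails when p is not in S (e.g. S=<2,3>, p=1, f the indicator of S); it is proved with the numerator sum over all n≥0 for every p≥1, and with the printed sum over n in S when p is in S. *)

(* Defs.v *)
From HB Require Import structures.
From mathcomp Require Import all_boot all_order all_algebra.
From mathcomp Require Import boolp classical_sets cardinality reals.

Set Implicit Arguments.
Unset Strict Implicit.
Unset Printing Implicit Defensive.

Import Order.TTheory GRing.Theory Num.Theory.
Local Open Scope ring_scope.

(* The ring R[[t]] of formal power series over a field R.  [fcoef a n] is the
   coefficient of t^n in a; the units are the series with nonzero constant
   term, so that [a / b] is the usual quotient when [fcoef b 0 != 0]. *)
Record fps (R : fieldType) := Fps { fcoef : nat -> R }.

Section FpsRing.
Variable R : fieldType.
Implicit Types a b c : fps R.

HB.instance Definition _ := gen_eqMixin (fps R).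
HB.instance Definition _ := gen_choiceMixin (fps R).

Lemma fpsP a b : (forall n, fcoef a n = fcoef b n) -> a = b.
Proof. by case: a b => [a] [b] /= eq_ab; congr Fps; apply/funext. Qed.

Definition fps_zero : fps R := Fps (fun=> 0).
Definition fps_opp a : fps R := Fps (fun n => - fcoef a n).
Definition fps_add a b : fps R := Fps (fun n => fcoef a n + fcoef b n).

Fact fps_addA : associative fps_add.
Proof. by move=> a b c; apply: fpsP => n /=; rewrite addrA. Qed.
Fact fps_addC : commutative fps_add.
Proof. by move=> a b; apply: fpsP => n /=; rewrite addrC. Qed.
Fact fps_add0 : left_id fps_zero fps_add.
Proof. by move=> a; apply: fpsP => n /=; rewrite add0r. Qed.
Fact fps_addN : left_inverse fps_zero fps_opp fps_add.
Proof. by move=> a; apply: fpsP => n /=; rewrite addNr. Qed.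

HB.instance Definition _ :=
  GRing.isZmodule.Build (fps R) fps_addA fps_addC fps_add0 fps_addN.

Definition fps_one : fps R := Fps (fun n => (n == 0)%:R).
Definition fps_mul a b : fps R :=
  Fps (fun n => \sum_(i < n.+1) fcoef a i * fcoef b (n - i)).

Definition fps_trunc N a : {poly R} := \poly_(i < N) fcoef a i.

Lemma fcoef_mul_trunc N a b n : (n < N)%N ->
  fcoef (fps_mul a b) n = (fps_trunc N a * fps_trunc N b)`_n.
Proof.
move=> ltnN; rewrite coefM /=; apply: eq_bigr => i _.
rewrite !coef_poly (leq_ltn_trans (leq_subr _ _) ltnN).
by rewrite (leq_ltn_trans _ ltnN) // -ltnS.
Qed.

Fact fps_mulC : commutative fps_mul.
Proof.
by move=> a b; apply: fpsP => n; rewrite !(@fcoef_mul_trunc n.+1) // mulrC.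
Qed.

Fact fps_mulA : associative fps_mul.
Proof.
move=> a b c; apply: fpsP => n.
pose T := fps_trunc n.+1.
transitivity ((T a * (T b * T c))`_n).
  rewrite coefM /=; apply: eq_bigr => i _.
  rewrite coef_poly ltn_ord -fcoef_mul_trunc //.
  by rewrite ltnS leq_subr.
rewrite mulrA coefM /=; apply: eq_bigr => i _.
by rewrite coef_poly ltnS leq_subr -fcoef_mul_trunc.
Qed.

Fact fps_mul1 : left_id fps_one fps_mul.
Proof.
move=> a; apply: fpsP => n /=; rewrite big_ord_recl /= mul1r subn0.
by rewrite big1 ?addr0 // => i _; rewrite mul0r.
Qed.

Fact fps_mulDl : left_distributive fps_mul fps_add.
Proof.
move=> a b c; apply: fpsP => n /=; rewrite -big_split /=.
by apply: eq_bigr => i _; rewrite mulrDl.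
Qed.

Fact fps_one_neq0 : fps_one != 0.
Proof.
apply/eqP => /(congr1 (fun a => fcoef a 0)) /= /eqP.
by rewrite oner_eq0.
Qed.

HB.instance Definition _ := GRing.Zmodule_isComNzRing.Build (fps R)
  fps_mulA fps_mulC fps_mul1 fps_mulDl fps_one_neq0.

Definition fps_unit : {pred fps R} := [pred a | fcoef a 0 != 0].

(* The first n coefficients of a^-1, by the recursion obtained from
   \sum_(i <= m) (a^-1)_i * a_(m - i) = (m == 0)%:R. *)
Fixpoint fps_inv_seq a n : seq R :=
  if n is m.+1 then
    let s := fps_inv_seq a m in
    rcons s ((fcoef a 0)^-1 *
             ((m == 0)%:R - \sum_(i < m) s`_i * fcoef a (m - i)))
  else [::].

Definition fps_inv a : fps R :=
  if a \in fps_unit then Fps (fun n => (fps_inv_seq a n.+1)`_n) else a.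

Lemma size_fps_inv_seq a n : size (fps_inv_seq a n) = n.
Proof. by elim: n => //= n IHn; rewrite size_rcons IHn. Qed.

Lemma nth_fps_inv_seq a n i : (i < n)%N ->
  (fps_inv_seq a n)`_i = (fps_inv_seq a i.+1)`_i.
Proof.
elim: n => // n IHn; rewrite ltnS leq_eqVlt => /predU1P[-> //|ltin].
by rewrite [fps_inv_seq a n.+1]/= nth_rcons size_fps_inv_seq ltin IHn.
Qed.

Fact fps_mulVx : {in fps_unit, left_inverse 1 fps_inv *%R}.
Proof.
move=> a ua; apply: fpsP => n.
change (fcoef (fps_mul (fps_inv a) a) n = (n == 0)%:R).
rewrite /fps_inv ua.
pose v i := (fps_inv_seq a i.+1)`_i.
have vE : v n = (fcoef a 0)^-1 *
    ((n == 0)%:R - \sum_(i < n) v i * fcoef a (n - i)).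
  rewrite /v [LHS]/= nth_rcons size_fps_inv_seq ltnn eqxx.
  by under eq_bigr => i _ do rewrite (nth_fps_inv_seq a (ltn_ord i)).
change (\sum_(i < n.+1) v i * fcoef a (n - i) = (n == 0)%:R).
rewrite big_ord_recr -/v; move: v vE => v vE /=.
by rewrite subnn vE mulrAC mulVf // mul1r addrC subrK.
Qed.

Fact fps_unitPl a b : b * a = 1 -> fps_unit a.
Proof.
move=> /(congr1 (fun c => fcoef c 0)).
change (fcoef (fps_mul b a) 0 = 1 -> fps_unit a).
rewrite /= big_ord1 => ba1; apply/negP => /eqP a0.
by move: ba1 => /eqP; rewrite a0 mulr0 eq_sym oner_eq0.
Qed.

Fact fps_inv_out : {in [predC fps_unit], fps_inv =1 id}.
Proof. by move=> a; rewrite inE /= /fps_inv => /negbTE ->. Qed.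

HB.instance Definition _ := GRing.ComNzRing_hasMulInverse.Build (fps R)
  fps_mulVx fps_unitPl fps_inv_out.

End FpsRing.

Definition fpsX {R : fieldType} : fps R := Fps (fun n => (n == 1)%:R).

(* \sum_(n in A) c n * t^n, for A a set of nonnegative integers. *)
Definition genseries {R : fieldType} (A : set int) (c : int -> R) : fps R :=
  Fps (fun n : nat => if n%:Z \in A then c n%:Z else 0).

Definition nonneg_ints : set int := [set n : int | 0 <= n]%classic.

Definition numerical_semigroup (S : set int) : Prop :=
  [/\ (S `<=` nonneg_ints)%classic,
      S 0,
      forall m n, S m -> S n -> S (m + n)
    & finite_set (nonneg_ints `\` S)%classic].

Definition semigroup_span {k : nat} (g : 'I_k -> nat) : set int :=
  [set n : int | exists a : 'I_k -> nat, n = (\sum_(i < k) a i * g i)%N%:Z]%classic.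

Definition S_invariant {R : realType} (S : set int) (f : int -> R) : Prop :=
  forall n : int, ~ S n -> f n = 0.

(* For n outside S this vanishes when p is in S, but not in general: for
   S = <2, 3>, p = 1 and f the indicator of S its value at 1 is -2.  Hence the
   series of second differences has to run over all n >= 0 for arbitrary p, and
   may be restricted to S when p is in S. *)
Definition second_difference {R : realType} (f : int -> R) (p : nat)
    (n : int) : R :=
  f n - 2 * f (n - p%:Z) + f (n - 2 * p%:Z).

Definition gen_sum {k : nat} (g : 'I_k -> nat) (F : {set 'I_k}) : int :=
  (\sum_(i in F) g i)%N%:Z.

Definition sqfree_divisor_complex {k : nat} (g : 'I_k -> nat) (S : set int)
    (n : int) : {set {set 'I_k}} :=
  [set F : {set 'I_k} | n - gen_sum g F \in S].

Definition weighted_euler_char {R : realType} {k : nat} (g : 'I_k -> nat)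
    (S : set int) (f : int -> R) (n : int) : R :=
  \sum_(F in sqfree_divisor_complex g S n) (-1) ^+ #|F| * f (n - gen_sum g F).

Definition augmented_hilbert_series {R : realType} (S : set int)
    (f : int -> R) : fps R := genseries S f.

(* Main.v *)
(* Multiplying a series by t^m shifts its coefficients, and f vanishes on
   negative integers.  Hence multiplying the Hilbert series by (1 - t^p)^2
   replaces f by its second difference (which vanishes off S when p is in S),
   while multiplying it by
   \prod_i (1 - t^(n_i)) = \sum_F (-1)^|F| t^(n_F) replaces f n by the sum of
   (-1)^|F| f (n - n_F) over all F; the terms with n - n_F outside S vanish,
   which leaves the weighted Euler characteristic.  The denominators are
   invertible because their constant term is 1. *)
Require Import Defs.
From mathcomp Require Import all_boot all_order all_algebra.
From mathcomp Require Import boolp classical_sets cardinality reals.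

Set Implicit Arguments.
Unset Strict Implicit.
Unset Printing Implicit Defensive.

Import Order.TTheory GRing.Theory Num.Theory.
Local Open Scope ring_scope.

Section FpsShift.
Variable R : fieldType.
Implicit Types (a : fps R) (c : int -> R) (A B : set int).

Lemma fcoefD a b n : fcoef (a + b) n = fcoef a n + fcoef b n.
Proof. by []. Qed.

Lemma fcoefN a n : fcoef (- a) n = - fcoef a n.
Proof. by []. Qed.

Lemma fcoefM a b n :
  fcoef (a * b) n = \sum_(i < n.+1) fcoef a i * fcoef b (n - i).
Proof. by []. Qed.

Lemma fcoef1 n : fcoef (1 : fps R) n = (n == 0%N)%:R.
Proof. by []. Qed.

Lemma fcoef_sum (I : finType) (P : pred I) (F : I -> fps R) n :
  fcoef (\sum_(i | P i) F i) n = \sum_(i | P i) fcoef (F i) n.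
Proof. by apply: (big_morph (fun a => fcoef a n)) => // a b. Qed.

Lemma fcoef_signM e a n : fcoef ((-1) ^+ e * a) n = (-1) ^+ e * fcoef a n.
Proof. by rewrite -![(-1) ^+ e]signr_odd; case: odd; rewrite ?mul1r ?mulN1r. Qed.

Lemma fcoefMX a n : fcoef (a * fpsX) n = if n is m.+1 then fcoef a m else 0.
Proof.
rewrite fcoefM; case: n => [|n]; first by rewrite big_ord1 /= mulr0.
rewrite !big_ord_recr /= subnn subSnn mulr0 mulr1 addr0 big1 ?add0r // => i _.
by rewrite subSn 1?ltnW // eqSS subn_eq0 leqNgt ltn_ord mulr0.
Qed.

(** This allows passing from [S] to [nonneg_ints], where coefficients carry no membership test and
    shifts are easy to compute. *)
Lemma genseries_support A B c : (A `<=` B)%classic ->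
  (forall n, B n -> ~ A n -> c n = 0) -> genseries A c = genseries B c.
Proof.
move=> sAB c0; apply: fpsP => n /=; case: ifPn => [/set_mem/sAB/mem_set -> //|].
by move=> /negP nA; case: ifP => // /set_mem Bn; rewrite c0 // => /mem_set.
Qed.

Lemma fcoef_genseries_nonneg c n : fcoef (genseries nonneg_ints c) n = c n%:Z.
Proof. by rewrite /= mem_set. Qed.

(** Each factor [fpsX] shifts the coefficients by one place and puts 0 in degree 0. Vanishing of [c]
    below 0 makes the shifted function agree there too. *)
Lemma genseries_mulXn c m : (forall n : int, n < 0 -> c n = 0) ->
  genseries nonneg_ints c * fpsX ^+ m
    = genseries nonneg_ints (fun n => c (n - m%:Z)).
Proof.
move=> c0; elim: m => [|m IHm].
  by rewrite mulr1; congr genseries; apply/funext => n; rewrite subr0.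
rewrite exprSr mulrA IHm; apply: fpsP => n.
rewrite fcoefMX fcoef_genseries_nonneg; case: n => [|n].
  by rewrite c0 // sub0r oppr_lt0.
rewrite fcoef_genseries_nonneg; congr c.
by rewrite -addn1 -(addn1 m) !PoszD opprD addrACA subrr addr0.
Qed.

Lemma unit_fcoef a : (a \is a GRing.unit) = (fcoef a 0 != 0).
Proof. by []. Qed.

Lemma unit_1subXn m : (0 < m)%N -> 1 - fpsX ^+ m \is a @GRing.unit (fps R).
Proof.
case: m => // m _.
by rewrite unit_fcoef fcoefD fcoefN exprSr fcoefMX subr0 fcoef1 oner_eq0.
Qed.

End FpsShift.

Lemma prod_1subXn (R : fieldType) k (g : 'I_k -> nat) :
  \prod_(i < k) (1 - fpsX ^+ g i : fps R)
    = \sum_(F : {set 'I_k}) (-1) ^+ #|F| * fpsX ^+ (\sum_(i in F) g i)%N.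
Proof.
(* With [- fpsX ^+ g i] as first summand, the set [F] in [bigA_distr] collects the factors from
   which this term is chosen. *)
under eq_bigr do rewrite addrC.
rewrite bigA_distr; apply: eq_bigr => F _.
by rewrite -big_mkcond /= prodrN expr_sum.
Qed.

Lemma weighted_euler_charE (R : realType) k (g : 'I_k -> nat) S
    (f : int -> R) n : S_invariant S f ->
  weighted_euler_char g S f n
    = \sum_(F : {set 'I_k}) (-1) ^+ #|F| * f (n - gen_sum g F).
Proof.
move=> f_inv; rewrite [RHS](bigID (mem (sqfree_divisor_complex g S n))) /=.
rewrite [X in _ + X]big1 ?addr0 // => F; rewrite inE => /negP nF.
by rewrite f_inv ?mulr0 // => /mem_set.
Qed.

(** The coefficients are the indicator of [F]. Since $n_F \in S$, subtracting $n_F$ from an integer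
    outside $S$ stays outside $S$. *)
Lemma gen_sum_span k (g : 'I_k -> nat) F : semigroup_span g (gen_sum g F).
Proof.
exists (fun i => (i \in F) : nat); congr Posz; rewrite big_mkcond /=.
by apply: eq_bigr => i _; case: (i \in F); rewrite ?mul1n.
Qed.

Theorem proposition3p3 (R : realType) (k : nat) (g : 'I_k -> nat)
    (S : set int) (f : int -> R) (p : nat)
    (g_gt0 : forall i, (0 < g i)%N)
    (g_incr : forall i j : 'I_k, (i < j)%N -> (g i < g j)%N)
    (S_numsgp : numerical_semigroup S)
    (S_gen : S = semigroup_span g)
    (f_inv : S_invariant S f)
    (p_ge1 : (1 <= p)%N) :
  [/\ augmented_hilbert_series S f
        = genseries nonneg_ints (second_difference f p) / (1 - fpsX ^+ p) ^+ 2,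
      p%:Z \in S ->
        augmented_hilbert_series S f
          = genseries S (second_difference f p) / (1 - fpsX ^+ p) ^+ 2
    & augmented_hilbert_series S f
        = genseries S (weighted_euler_char g S f)
            / \prod_(i < k) (1 - fpsX ^+ g i)].
Proof.
have [S_ge0 _ S_add _] := S_numsgp.
have f_lt0 n : n < 0 -> f n = 0.
  by move=> n0; apply: f_inv => /S_ge0 /=; rewrite /nonneg_ints /= leNgt n0.
(* If [n - m] were in [S], then so would be [n = (n - m) + m]. *)
have f_sub m n : S m -> ~ S n -> f (n - m) = 0.
  by move=> Sm nSn; apply: f_inv => /S_add/(_ Sm); rewrite subrK.
have HE : augmented_hilbert_series S f = genseries nonneg_ints f.
  by apply: genseries_support => // n _ /f_inv.
have diffE : augmented_hilbert_series S f
    = genseries nonneg_ints (second_difference f p) / (1 - fpsX ^+ p) ^+ 2.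
  apply: (canRL (mulrK _)); first exact/unitrX/unit_1subXn.
  apply: fpsP => n; rewrite HE sqrrB expr1n mul1r mulrDr mulrBr mulr1 mulrnAr -exprM muln2.
  rewrite fcoefD fcoefD fcoefN mulr2n fcoefD !genseries_mulXn //.
  rewrite !fcoef_genseries_nonneg /second_difference.
  by rewrite -addnn PoszD !mulr_natl !mulr2n.
split => // [Sp|].
  (* Off [S] all three terms of the second difference vanish, because both [p] and [2 * p] lie in
     [S]. *)
  rewrite diffE; congr (_ / _); apply/esym/genseries_support => // n _ nSn.
  have {}Sp := set_mem Sp.
  rewrite /second_difference f_inv // f_sub //.
  have -> : 2 * p%:Z = p%:Z + p%:Z by rewrite mulr_natl.
  by rewrite f_sub ?mulr0 ?subr0 ?addr0 //; apply: S_add.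
apply: (canRL (mulrK _)).
  by apply: rpred_prod => i _; apply: unit_1subXn.
(* Off [S] every summand of the Euler characteristic vanishes, so the series may run over all
   [n >= 0]. *)
have -> : genseries S (weighted_euler_char g S f)
    = genseries nonneg_ints (weighted_euler_char g S f).
  apply: genseries_support => // n _ nSn; rewrite weighted_euler_charE //.
  rewrite big1 // => F _; rewrite f_sub ?mulr0 // S_gen.
  exact: gen_sum_span.
rewrite HE prod_1subXn mulr_sumr; apply: fpsP => n.
rewrite fcoef_sum fcoef_genseries_nonneg weighted_euler_charE //.
apply: eq_bigr => F _.
by rewrite mulrCA fcoef_signM genseries_mulXn // fcoef_genseries_nonneg.
Qed.
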